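(* Let $C_0\ge 1$ and $h>0$ be fixed real numbers, let $s\ge 1$ be a fixed integer and let $\lambda_1,\dots,\lambda_s\ge 0$ be fixed real numbers. For each $n\ge 1$ let $X_1,\dots,X_n$ (whose joint distribution may depend on $n$) be 1-dependent, not necessarily identically distributed random variables taking values in the nonnegative integers with $X_i\le C_0$ for $1\le i\le n$. Let $S_n=X_1+\cdots+X_n$, and let $F_n(k)=P(S_n\le k)$ and $\mathrm{CP}(s,\lambda)(k)=\mathrm{CP}(s,\lambda)\{[0,k]\}$ be the distribution functions of $S_n$ and of $\mathrm{CP}(s,\lambda)$. Let $\nu_j(k)=\mathrm{E}\,X_k(X_k-1)\cdots(X_k-j+1)$. Suppose that, as $n\to\infty$, $$\max_{1\le j\le n}\nu_1(j)\to 0,$$ $$\frac{1}{m!}\sum_{j=1}^n\nu_m(j)\to\sum_{l=m}^s\binom{l}{m}\lambda_l,\qquad m=1,2,\dots,s,$$ $$\sum_{j=1}^n\nu_{s+1}(j)\to 0,$$ $$\sum_{j=2}^n|\mathrm{Cov}(X_{j-1},X_j)|\to 0.$$ Then, as $n\to\infty$, $$\sum_{k=0}^\infty e^{hk}\,\bigl|F_n(k)-\mathrm{CP}(s,\lambda)(k)\bigr|\to 0.$$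
   Context: Random variables $X_1,\dots,X_n$ are 1-dependent if for all $1\le p<q\le n$ with $q-p>1$ the sigma-algebras generated by $X_1,\dots,X_p$ and by $X_q,\dots,X_n$ are independent. $\mathrm{CP}(s,\lambda)=\mathrm{CP}(s,\lambda_1,\dots,\lambda_s)$ is the compound Poisson distribution of $N_1+2N_2+\cdots+sN_s$, where $N_1,\dots,N_s$ are independent Poisson random variables with means $\lambda_1,\dots,\lambda_s$. *)

(* Defs.v *)
From HB Require Import structures.
From mathcomp Require Import all_boot all_order all_algebra.
From mathcomp Require Import all_classical all_reals all_analysis.

Set Implicit Arguments.
Unset Strict Implicit.
Unset Printing Implicit Defensive.

Import Order.TTheory GRing.Theory Num.Theory.
Import numFieldNormedType.Exports.

Local Open Scope classical_set_scope.
Local Open Scope ring_scope.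

Section one_dependence.
Context {d : measure_display} {T : measurableType d} {R : realType}.

Definition independent_set_systems (P : probability T R)
    (F G : set (set T)) : Prop :=
  forall A B, F A -> G B -> P (A `&` B) = (P A * P B)%E.

(* The sigma-algebra generated by [X a], ..., [X b]. *)
Definition sigma_segment (X : nat -> T -> nat) (a b : nat) : set (set T) :=
  g_sigma_preimage (fun i : 'I_(b.+1 - a) => X (a + i)%N).

(* Only the variables [X 1], ..., [X n] matter. *)
Definition one_dependent (P : probability T R) (n : nat)
    (X : nat -> T -> nat) : Prop :=
  forall p q : nat, (1 <= p)%N -> (p < q)%N -> (q <= n)%N -> (1 < q - p)%N ->
    independent_set_systems P (sigma_segment X 1 p) (sigma_segment X q n).

(* [x ^_ m] is the falling factorial x (x - 1) ... (x - m + 1). *)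
Definition factorial_moment (P : probability T R) (Y : T -> nat) (m : nat)
    : \bar R :=
  'E_P[fun w => (Y w ^_ m)%:R]%E.

End one_dependence.

Section compound_poisson.
Context {R : realType}.

Definition cons_pair (s : nat) (x : nat * s.-tuple nat) : s.+1.-tuple nat :=
  [the s.+1.-tuple nat of x.1 :: x.2].

Lemma measurable_cons_pair (s : nat) : measurable_fun setT (@cons_pair s).
Proof. by apply: measurable_cons. Qed.

HB.instance Definition _ (s : nat) :=
  isMeasurableFun.Build _ _ _ _ (@cons_pair s) (@measurable_cons_pair s).

(* The product of the Poisson distributions with means [lam 1], ..., [lam s]:
   under it the coordinates N_1, ..., N_s of a tuple are independent, with
   N_j (that is [tnth N] at position j - 1) Poisson with mean [lam j].  The
   library's [poisson_prob] is the Dirac mass at 0 when the mean is 0, and its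
   second argument is a dummy. *)
Fixpoint poisson_product (s : nat) (lam : nat -> R)
    : probability (s.-tuple nat) R :=
  match s return probability (s.-tuple nat) R with
  | 0%N => dirac [tuple]
  | s'.+1 => distribution
      (poisson_prob (lam 1%N) 0%N \x
       poisson_product s' (fun j => lam j.+1))%E
      (@cons_pair s')
  end.

(* N_1 + 2 N_2 + ... + s N_s *)
Definition weighted_sum (s : nat) (N : s.-tuple nat) : nat :=
  (\sum_(j < s) j.+1 * tnth N j)%N.

Lemma measurable_weighted_sum (s : nat) : measurable_fun setT (@weighted_sum s).
Proof.
move=> _ B _; rewrite setTI; apply: countable_measurable; last exact: countableP.
move=> t.
have -> : [set t] = \bigcap_(i in [set: 'I_s]) (@tnth s nat ^~ i @^-1` [set tnth t i]).
  apply/seteqP; split=> [u -> //|u ut].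
  by apply: eq_from_tnth => i; exact: ut.
apply: fin_bigcap_measurable => // i _.
by rewrite -[X in measurable X]setTI; exact: measurable_tnth.
Qed.

HB.instance Definition _ (s : nat) :=
  isMeasurableFun.Build _ _ _ _ (@weighted_sum s) (@measurable_weighted_sum s).

Definition compound_poisson (s : nat) (lam : nat -> R) : probability nat R :=
  distribution (poisson_product s lam) (@weighted_sum s).

End compound_poisson.

(* Main.v *)
(** Everything runs through the probability generating function.  Put
    U_k = 1 - z^(X_k) and a_k = E z^(S_k) for z in [0,1].  Then
    a_k = a_(k-1) - E[z^(S_(k-1)) U_k], and replacing z^(S_(k-1)) by z^(S_(k-2)),
    which is independent of U_k by 1-dependence, costs at most
    E[X_(k-1) X_k].  Hence a_k = a_(k-1) exp(- E U_k) up to an error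
    nu_1(k)^2 + E[X_(k-1) X_k] + nu_1(k-1) nu_1(k), whose sum over k tends to 0,
    so that E z^(S_n) is asymptotically exp(- sum_k E U_k).  Expanding z^x in
    falling factorials of x around z = 1 identifies the limit of the exponent
    as sum_l lambda_l (z^l - 1), the exponent of the compound Poisson law.
    Convergence of the generating functions on [0,1] gives pointwise convergence
    of the distribution functions.  The same recursion applied to exp(a S_k)
    bounds the exponential moments of S_n uniformly in n, so by Markov's
    inequality the weighted differences are dominated by a geometric series. *)
Require Import Defs.
From mathcomp Require Import all_boot all_order all_algebra.
From mathcomp Require Import all_classical all_reals all_analysis.
From mathcomp Require Import measurable_realfun.
From mathcomp Require Import ring lra.

Import Order.TTheory GRing.Theory Num.Theory.
Import numFieldNormedType.Exports.

Local Open Scope classical_set_scope.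
Local Open Scope ring_scope.

(** * Integrals of bounded measurable functions against a probability *)

Section bounded_measurable.
Context {d : measure_display} {T : measurableType d} {R : realType}.
Implicit Types f g : T -> R.

(** Unlike integrability, this property passes to products. The integrands built from the bounded
    variables [X 1], ..., [X n] all have it, so linearity and monotonicity of the integral apply to
    them without separate integrability arguments. *)
Definition bounded_measurable f : Prop :=
  measurable_fun setT f /\ exists M : R, forall w, `|f w| <= M.

Lemma bounded_measurable_cst (c : R) : bounded_measurable (fun=> c).
Proof. by split; [exact: measurable_cst|exists `|c|]. Qed.

Lemma bounded_measurableD f g : bounded_measurable f -> bounded_measurable g ->
  bounded_measurable (fun w => f w + g w).
Proof.
move=> [mf [M fM]] [mg [N gN]]; split; first exact: measurable_funD.
by exists (M + N) => w; rewrite (le_trans (ler_normD _ _))// lerD.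
Qed.

Lemma bounded_measurableM f g : bounded_measurable f -> bounded_measurable g ->
  bounded_measurable (fun w => f w * g w).
Proof.
move=> [mf [M fM]] [mg [N gN]]; split; first exact: measurable_funM.
by exists (M * N) => w; rewrite normrM ler_pM.
Qed.

Lemma bounded_measurableB f g : bounded_measurable f -> bounded_measurable g ->
  bounded_measurable (fun w => f w - g w).
Proof.
move=> bf bg; rewrite (_ : (fun w => _) = fun w => f w + -1 * g w).
  apply: bounded_measurableD => //; apply: bounded_measurableM => //.
  exact: bounded_measurable_cst.
by apply/funext => w; rewrite mulN1r.
Qed.

Lemma bounded_measurable_sum (I : Type) (r : seq I) (F : I -> T -> R) :
  (forall i, bounded_measurable (F i)) ->
  bounded_measurable (fun w => \sum_(i <- r) F i w).
Proof.
move=> bF; elim: r => [|i r IH].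
  rewrite (_ : (fun w => _) = fun=> 0); first exact: bounded_measurable_cst.
  by apply/funext => w; rewrite big_nil.
rewrite (_ : (fun w => _) = fun w => F i w + \sum_(j <- r) F j w).
  exact: bounded_measurableD.
by apply/funext => w; rewrite big_cons.
Qed.

Lemma measurable_fun_nat_comp (phi : nat -> R) (Y : T -> nat) :
  measurable_fun setT Y -> measurable_fun setT (fun w => phi (Y w)).
Proof. by move=> mY; apply: (@measurableT_comp _ _ _ _ _ _ phi). Qed.

Lemma bounded_measurable_nat (phi : nat -> R) (Y : T -> nat) (N : nat) :
  measurable_fun setT Y -> (forall w, (Y w <= N)%N) ->
  bounded_measurable (fun w => phi (Y w)).
Proof.
move=> mY YN; split; first exact: measurable_fun_nat_comp.
exists (\sum_(i < N.+1) `|phi i|) => w.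
have YNw : (Y w < N.+1)%N by rewrite ltnS.
by rewrite (bigD1 (Ordinal YNw))//= lerDl sumr_ge0.
Qed.

Lemma bounded_measurable_indic (A : set T) : measurable A ->
  bounded_measurable (\1_A : T -> R).
Proof.
move=> mA; split; first exact: measurable_indic.
by exists 1 => w; rewrite ger0_norm// indicE; case: (w \in A); rewrite /= ?mulr0n ?mulr1n.
Qed.

Context (P : probability T R).

Lemma bounded_measurable_integrable f : bounded_measurable f ->
  P.-integrable setT (EFin \o f).
Proof.
move=> [mf [M fM]]; apply: measurable_bounded_integrable => //.
- exact: (le_lt_trans (probability_le1 _ _) (ltry _)).
- exists M; split; first exact: num_real.
  by move=> x Mx w _ /=; apply: (le_trans (fM w)); exact: ltW.
Qed.

Lemma EFin_Rintegral f : bounded_measurable f ->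
  (\int[P]_w f w)%:E = (\int[P]_w (f w)%:E)%E.
Proof.
move=> bf; rewrite /Rintegral fineK//.
by apply: integrable_fin_num => //; exact: bounded_measurable_integrable.
Qed.

Lemma prob_Rintegral_cst (c : R) : \int[P]_w c = c.
Proof. by rewrite Rintegral_cst// [X in fine X]probability_setT mulr1. Qed.

Lemma bm_RintegralD f g : bounded_measurable f -> bounded_measurable g ->
  \int[P]_w (f w + g w) = \int[P]_w f w + \int[P]_w g w.
Proof. by move=> bf bg; rewrite RintegralD//; exact: bounded_measurable_integrable. Qed.

Lemma bm_RintegralB f g : bounded_measurable f -> bounded_measurable g ->
  \int[P]_w (f w - g w) = \int[P]_w f w - \int[P]_w g w.
Proof. by move=> bf bg; rewrite RintegralB//; exact: bounded_measurable_integrable. Qed.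

Lemma bm_RintegralZl f c : bounded_measurable f ->
  \int[P]_w (c * f w) = c * \int[P]_w f w.
Proof. by move=> bf; rewrite RintegralZl//; exact: bounded_measurable_integrable. Qed.

Lemma bm_le_Rintegral f g : bounded_measurable f -> bounded_measurable g ->
  (forall w, f w <= g w) -> \int[P]_w f w <= \int[P]_w g w.
Proof. by move=> bf bg fg; apply: le_Rintegral => //; exact: bounded_measurable_integrable. Qed.

Lemma bm_normr_Rintegral f g : bounded_measurable f -> bounded_measurable g ->
  (forall w, `|f w| <= g w) -> `|\int[P]_w f w| <= \int[P]_w g w.
Proof.
move=> bf bg fg; rewrite (le_trans (le_normr_Rintegral _ _))//.
  exact: bounded_measurable_integrable.
apply: bm_le_Rintegral => //; case: bf => mf [M fM].
split; first by apply/measurableT_comp.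
by exists M => w; rewrite normr_id.
Qed.

Lemma bm_Rintegral_sum (I : Type) (r : seq I) (F : I -> T -> R) :
  (forall i, bounded_measurable (F i)) ->
  \int[P]_w (\sum_(i <- r) F i w) = \sum_(i <- r) \int[P]_w F i w.
Proof.
move=> bF; elim: r => [|i r IH].
  under eq_Rintegral do rewrite big_nil.
  by rewrite big_nil; exact: (prob_Rintegral_cst 0).
under eq_Rintegral do rewrite big_cons.
by rewrite big_cons bm_RintegralD ?IH//; exact: bounded_measurable_sum.
Qed.

Lemma Rintegral_indic (A : set T) : measurable A ->
  \int[P]_w \1_A w = fine (P A).
Proof. by move=> mA; rewrite /Rintegral integral_indic// setIT. Qed.

Lemma measurable_nat_preimage (Y : T -> nat) (A : set nat) :
  measurable_fun setT Y -> measurable (Y @^-1` A).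
Proof. by move=> mY; rewrite -[X in measurable X]setTI; exact: mY. Qed.

(** A bounded variable with values in [nat] takes finitely many values, so [phi (Y w)] and
    [psi (Z w)] are finite combinations of indicators of level sets. The product rule for these sets
    then extends by bilinearity. *)
Lemma independent_Rintegral_nat (phi psi : nat -> R) (Y Z : T -> nat) (M N : nat) :
  measurable_fun setT Y -> (forall w, (Y w <= M)%N) ->
  measurable_fun setT Z -> (forall w, (Z w <= N)%N) ->
  (forall i j, P (Y @^-1` [set i] `&` Z @^-1` [set j]) =
               (P (Y @^-1` [set i]) * P (Z @^-1` [set j]))%E) ->
  \int[P]_w (phi (Y w) * psi (Z w)) =
  (\int[P]_w phi (Y w)) * (\int[P]_w psi (Z w)).
Proof.
move=> mY YM mZ ZN indYZ.
have expand (rho : nat -> R) (V : T -> nat) (K : nat) w : (V w <= K)%N ->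
    rho (V w) = \sum_(i < K.+1) rho i * \1_(V @^-1` [set i : nat]) w.
  rewrite -ltnS => VK; rewrite (bigD1 (Ordinal VK))//= big1 ?addr0.
    by rewrite indicE mem_set// mulr1.
  move=> i /eqP iV; rewrite indicE memNset ?mulr0// => /= Vi; apply: iV.
  exact: val_inj.
have bI (V : T -> nat) (i : nat) : measurable_fun setT V ->
    bounded_measurable (\1_(V @^-1` [set i]) : T -> R).
  by move=> mV; apply: bounded_measurable_indic; exact: measurable_nat_preimage.
have bcI (c : R) (V : T -> nat) (i : nat) : measurable_fun setT V ->
    bounded_measurable (fun w => c * \1_(V @^-1` [set i]) w).
  by move=> mV; apply: bounded_measurableM; [exact: bounded_measurable_cst|exact: bI].
have law (rho : nat -> R) (V : T -> nat) (K : nat) :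
    measurable_fun setT V -> (forall w, (V w <= K)%N) ->
    \int[P]_w rho (V w) = \sum_(i < K.+1) rho i * fine (P (V @^-1` [set i : nat])).
  move=> mV VK; under eq_Rintegral do rewrite (expand rho V K)//.
  rewrite bm_Rintegral_sum => [|i]; last exact: bcI.
  apply: eq_bigr => i _; rewrite bm_RintegralZl; last exact: bI.
  by rewrite Rintegral_indic//; exact: measurable_nat_preimage.
under eq_Rintegral do rewrite (expand phi Y M)// (expand psi Z N)// big_distrlr/=.
rewrite (law phi Y M)// (law psi Z N)// big_distrlr/=.
have bII i j : bounded_measurable (fun w => phi i * \1_(Y @^-1` [set i]) w *
    (psi j * \1_(Z @^-1` [set j]) w)).
  by apply: bounded_measurableM; exact: bcI.
rewrite bm_Rintegral_sum => [|i]; last by apply: bounded_measurable_sum => j.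
apply: eq_bigr => i _; rewrite bm_Rintegral_sum => [|j]; last exact: bII.
apply: eq_bigr => j _.
have mij : measurable (Y @^-1` [set i : nat] `&` Z @^-1` [set j : nat]).
  by apply: measurableI; exact: measurable_nat_preimage.
transitivity (\int[P]_w (phi i * psi j * \1_(Y @^-1` [set i : nat] `&` Z @^-1` [set j : nat]) w)).
  by apply: eq_Rintegral => w _; rewrite indicI /= mulrACA.
rewrite bm_RintegralZl; last exact: bounded_measurable_indic.
rewrite Rintegral_indic// indYZ fineM; first by rewrite mulrACA.
  by rewrite fin_num_measure//; exact: measurable_nat_preimage.
by rewrite fin_num_measure//; exact: measurable_nat_preimage.
Qed.

End bounded_measurable.

(** * Partial sums and factorization under 1-dependence *)

Section one_dependent_sums.
Context {d : measure_display} {T : measurableType d} {R : realType}.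
Context (P : probability T R) (X : nat -> {RV P >-> nat}).

Definition partial_sum (k : nat) (w : T) : nat := (\sum_(1 <= i < k.+1) X i w)%N.

Lemma partial_sum0 w : partial_sum 0 w = 0%N.
Proof. by rewrite /partial_sum big_nil. Qed.

Lemma partial_sumS k w : partial_sum k.+1 w = (partial_sum k w + X k.+1 w)%N.
Proof. by rewrite /partial_sum big_nat_recr. Qed.

Lemma measurable_partial_sum k : measurable_fun setT (partial_sum k).
Proof.
elim: k => [|k IH].
  have -> : partial_sum 0 = cst 0%N by apply/funext => w; exact: partial_sum0.
  exact: measurable_cst.
rewrite (_ : partial_sum k.+1 = fun w => partial_sum k w + X k.+1 w)%N.
  by apply: measurable_fun_addn => //; exact: measurable_funPT.
by apply/funext => w; rewrite partial_sumS.
Qed.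

Lemma sigma_segment_preimage (Y : nat -> T -> nat) a b k (A : set nat) :
  (a <= k <= b)%N -> sigma_segment Y a b (Y k @^-1` A).
Proof.
move=> /andP[ak kb]; apply: sub_sigma_algebra.
have kab : (k - a < b.+1 - a)%N by rewrite ltn_sub2r// ltnS// (leq_trans ak).
rewrite (bigD1 (Ordinal kab))//=; left; exists A => //.
by rewrite setTI subnKC.
Qed.

(** Sums of measurable functions are measurable for any sigma-algebra, so the induction on [m] runs
    on the space equipped with the sigma-algebra generated by [X 1], ..., [X p]. *)
Lemma sigma_segment_partial_sum p m (A : set nat) : (m <= p)%N ->
  sigma_segment (fun i => X i) 1 p (partial_sum m @^-1` A).
Proof.
pose G : set (set T) := \big[setU/set0]_(i < p.+1 - 1)
  preimage_set_system setT (X (1 + i)%N) measurable.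
suff H : (m <= p)%N -> @measurable_fun _ _ (g_sigma_algebraType G) nat setT (partial_sum m).
  by move=> mp; have := H mp measurableT A I; rewrite setTI.
elim: m => [|m IH] mp.
  have -> : partial_sum 0 = cst 0%N by apply/funext => w; exact: partial_sum0.
  exact: measurable_cst.
rewrite (_ : partial_sum m.+1 = fun w => partial_sum m w + X m.+1 w)%N; last first.
  by apply/funext => w; rewrite partial_sumS.
apply: (@measurable_fun_addn _ (g_sigma_algebraType G)); first exact: IH (ltnW mp).
move=> _ B _; rewrite setTI.
exact: (@sigma_segment_preimage (fun i => X i) 1 p m.+1 B).
Qed.

Context (n N : nat).
Hypothesis X_le : forall i w, (1 <= i <= n)%N -> (X i w <= N)%N.
Hypothesis X_dep : one_dependent P n (fun i => X i).

Lemma partial_sum_le k w : (k <= n)%N -> (partial_sum k w <= k * N)%N.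
Proof.
elim: k => [|k IH] kn; first by rewrite partial_sum0.
by rewrite partial_sumS mulSn addnC leq_add// ?IH ?X_le// ltnW.
Qed.

Lemma bm_X (phi : nat -> R) k : (1 <= k <= n)%N ->
  bounded_measurable (fun w => phi (X k w)).
Proof.
by move=> kn; apply: bounded_measurable_nat => [|w]; [exact: measurable_funPT|exact: X_le].
Qed.

Lemma bm_partial_sum (phi : nat -> R) k : (k <= n)%N ->
  bounded_measurable (fun w => phi (partial_sum k w)).
Proof.
move=> kn; apply: bounded_measurable_nat; first exact: measurable_partial_sum.
by move=> w; exact: partial_sum_le.
Qed.

(* At [k = 0] the truncated [k.-1] leaves no gap, but the partial sum is then
   constant. *)
Lemma one_dependent_Rintegral (phi psi : nat -> R) k : (k < n)%N ->
  \int[P]_w (phi (partial_sum k.-1 w) * psi (X k.+1 w)) =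
  (\int[P]_w phi (partial_sum k.-1 w)) * (\int[P]_w psi (X k.+1 w)).
Proof.
move=> kn.
have [k1|k1] := leqP k 1.
  have -> : k.-1 = 0%N by case: k k1 {kn} => [|[]].
  under eq_Rintegral do rewrite partial_sum0.
  under [X in _ = X * _]eq_Rintegral do rewrite partial_sum0.
  by rewrite bm_RintegralZl ?prob_Rintegral_cst//; exact: bm_X.
apply: (@independent_Rintegral_nat _ _ _ _ _ _ _ _ (k.-1 * N) N).
- exact: measurable_partial_sum.
- by move=> w; apply: partial_sum_le; rewrite (leq_trans (leq_pred _))// ltnW.
- exact: measurable_funPT.
- by move=> w; exact: X_le.
move=> i j; apply: (@X_dep k.-1 k.+1).
- by rewrite -ltnS prednK// ltnW.
- by rewrite ltnS leq_pred.
- by [].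
- by rewrite ltn_subRL addn1 prednK// ltnW.
- exact: sigma_segment_partial_sum.
- by apply: (@sigma_segment_preimage (fun i => X i)); rewrite leqnn.
Qed.

End one_dependent_sums.

(** * Elementary inequalities and error propagation along a product *)

Section real_inequalities.
Context {R : realType}.

Lemma onem_exprn_bounds (z : R) (x : nat) : 0 <= z <= 1 ->
  0 <= 1 - z ^+ x <= x%:R.
Proof.
move=> /andP[z0 z1]; rewrite subr_ge0 exprn_ile1//=.
case: x => [|x]; first by rewrite expr0 subrr.
by rewrite (@le_trans _ _ 1)// ?ler1n// gerBl exprn_ge0.
Qed.

(** One side is [1 + x <= expR x] at [x = - u]. For the other, [expR (- u)] is at most
    [1 / (1 + u)], and [(1 + u) * (1 - u + u ^+ 2) = 1 + u ^+ 3] is at least 1. *)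
Lemma expRN_onem_bound (u : R) : 0 <= u -> `|1 - u - expR (- u)| <= u ^+ 2.
Proof.
move=> u0; rewrite ler_norml; apply/andP; split; last first.
  have := expR_ge1Dx (- u); nra.
have : expR (- u) <= 1 - u + u ^+ 2.
  rewrite expRN invf_ple ?posrE ?expR_gt0//; last by nra.
  apply: le_trans (expR_ge1Dx u).
  rewrite -[leLHS]mul1r ler_pdivrMr; nra.
nra.
Qed.

(** Multiplying by a factor of modulus at most 1 does not enlarge the error accumulated so far, so
    the one-step errors simply add up. *)
Lemma telescoping_product (a q e : nat -> R) n : a 0%N = 1 ->
  (forall k, `|q k| <= 1) ->
  (forall k, (k < n)%N -> `|a k.+1 - a k * q k| <= e k) ->
  `|a n - \prod_(0 <= k < n) q k| <= \sum_(0 <= k < n) e k.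
Proof.
move=> a0 q1 ae; elim: n ae => [|n IH] ae; first by rewrite !big_nil a0 subrr normr0.
rewrite !big_nat_recr//=.
have -> : a n.+1 - \prod_(0 <= i < n) q i * q n =
    (a n - \prod_(0 <= i < n) q i) * q n + (a n.+1 - a n * q n) by ring.
apply: le_trans (ler_normD _ _) _; apply: lerD; last exact: ae.
rewrite normrM -[leRHS]mulr1 ler_pM//.
by apply: IH => k kn; apply: ae; rewrite ltnW.
Qed.

End real_inequalities.

(** * Recursions for the generating function and for exponential moments *)

Section generating_function_bounds.
Context {d : measure_display} {T : measurableType d} {R : realType}.
Context (P : probability T R) (X : nat -> {RV P >-> nat}) (n N : nat).
Hypothesis X_le : forall i w, (1 <= i <= n)%N -> (X i w <= N)%N.
Hypothesis X_dep : one_dependent P n (fun i => X i).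

Local Notation S := (partial_sum P X).
Local Notation nu k := (\int[P]_w (X k w)%:R).

(* The factor [(0 < k)%:R] discards [X 0], about which nothing is assumed. *)
Lemma pgf_step (z : R) k : 0 <= z <= 1 -> (k < n)%N ->
  `|\int[P]_w (z ^+ S k.+1 w) -
    (\int[P]_w (z ^+ S k w)) * expR (- \int[P]_w (1 - z ^+ X k.+1 w))| <=
  nu k.+1 ^+ 2 + \int[P]_w ((0 < k)%:R * (X k w)%:R * (X k.+1 w)%:R) +
  (\int[P]_w ((0 < k)%:R * (X k w)%:R)) * nu k.+1.
Proof.
move=> z01 kn; have /andP[z0 z1] := z01.
have k1n : (1 <= k.+1 <= n)%N by [].
have bS m : (m <= n)%N -> bounded_measurable (fun w => z ^+ S m w).
  by move=> mn; exact: (bm_partial_sum _ _ _ _ X_le (fun x => z ^+ x)).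
have bX (phi : nat -> R) : bounded_measurable (fun w => phi (X k.+1 w)).
  exact: (bm_X _ _ _ _ X_le).
have bX' : bounded_measurable (fun w => (0 < k)%:R * (X k w)%:R : R).
  case: (posnP k) => [->|k0].
    rewrite (_ : (fun w => _) = fun=> 0); first exact: bounded_measurable_cst.
    by apply/funext => w; rewrite mul0r.
  by apply: (bm_X _ _ _ _ X_le (fun x => _ * x%:R)); rewrite k0 ltnW.
set U : T -> R := fun w => 1 - z ^+ X k.+1 w.
set u := \int[P]_w U w.
set a := fun m => \int[P]_w (z ^+ S m w).
have bU : bounded_measurable U by exact: (bX (fun x => 1 - z ^+ x)).
have U0 w : 0 <= U w by case/andP: (onem_exprn_bounds _ (X k.+1 w) z01).
have UX w : U w <= (X k.+1 w)%:R by case/andP: (onem_exprn_bounds _ (X k.+1 w) z01).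
have kn' : (k <= n)%N by exact: ltnW.
have k'n : (k.-1 <= n)%N by rewrite (leq_trans (leq_pred _)).
have u0 : 0 <= u by exact: Rintegral_ge0.
have unu : u <= nu k.+1 by apply: bm_le_Rintegral => //; exact: (bX (fun x => x%:R)).
have a0 m : 0 <= a m by apply: Rintegral_ge0 => w _; rewrite exprn_ge0.
have a1 : a k <= 1.
  rewrite -[leRHS](prob_Rintegral_cst P 1); apply: bm_le_Rintegral => [|| w].
  - exact: bS.
  - exact: bounded_measurable_cst.
  - by rewrite exprn_ile1.
(* For positive [k] the difference is [z ^+ S k.-1 w * (1 - z ^+ X k w)]. For [k = 0] it vanishes,
   because [k.-1] is again 0. *)
have gap w : 0 <= z ^+ S k.-1 w - z ^+ S k w <= (0 < k)%:R * (X k w)%:R.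
  case: k {kn k1n bX bX' U u bU U0 UX kn' k'n u0 unu a1} => [|k]/=.
    by rewrite subrr mul0r lexx.
  have -> : z ^+ S k w - z ^+ S k.+1 w = z ^+ S k w * (1 - z ^+ X k.+1 w).
    by rewrite partial_sumS exprD; ring.
  rewrite mul1r.
  have /andP[p0 p1] := onem_exprn_bounds _ (X k.+1 w) z01.
  rewrite mulr_ge0 ?exprn_ge0//= (le_trans _ p1)// ler_piMl//.
  by rewrite exprn_ile1.
have aS : a k.+1 = a k - \int[P]_w (z ^+ S k w * U w).
  rewrite -bm_RintegralB; last 2 first.
  - exact: bS.
  - by apply: bounded_measurableM => //; exact: bS.
  by apply: eq_Rintegral => w _; rewrite /U partial_sumS exprD; ring.
(* [D] is the cost of passing from [S k] to [S k.-1], after which 1-dependence factorizes the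
   expectation as [a k.-1 * u]. *)
set D := \int[P]_w ((z ^+ S k.-1 w - z ^+ S k w) * U w).
have bgap : bounded_measurable (fun w => z ^+ S k.-1 w - z ^+ S k w).
  by apply: bounded_measurableB; exact: bS.
have DE : \int[P]_w (z ^+ S k w * U w) = a k.-1 * u - D.
  rewrite -(one_dependent_Rintegral _ _ _ _ X_le X_dep (fun x => z ^+ x) (fun x => 1 - z ^+ x))//.
  rewrite -bm_RintegralB; last 2 first.
  - by apply: bounded_measurableM => //; exact: bS.
  - exact: bounded_measurableM.
  by apply: eq_Rintegral => w _; rewrite /U; ring.
have D0 : 0 <= D.
  by apply: Rintegral_ge0 => w _; rewrite mulr_ge0//; case/andP: (gap w).
have DX : D <= \int[P]_w ((0 < k)%:R * (X k w)%:R * (X k.+1 w)%:R).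
  apply: bm_le_Rintegral => [||w].
  - exact: bounded_measurableM.
  - by apply: bounded_measurableM => //; exact: (bX (fun x => x%:R)).
  - by apply: ler_pM => //; case/andP: (gap w).
have aaE : a k.-1 - a k = \int[P]_w (z ^+ S k.-1 w - z ^+ S k w).
  by rewrite bm_RintegralB//; exact: bS.
have aa0 : 0 <= a k.-1 - a k.
  by rewrite aaE; apply: Rintegral_ge0 => w _; case/andP: (gap w).
have aaX : a k.-1 - a k <= \int[P]_w ((0 < k)%:R * (X k w)%:R).
  by rewrite aaE; apply: bm_le_Rintegral => // w; case/andP: (gap w).
(* The three sources of error match the three terms of the bound: linearizing the exponential costs
   [u ^+ 2], decoupling costs [D], and returning from [a k.-1] to [a k] costs their difference times
   [u]. *)
have -> : a k.+1 - a k * expR (- u) =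
    a k * (1 - u - expR (- u)) + (D - (a k.-1 - a k) * u) by rewrite aS DE; ring.
apply: le_trans (ler_normD _ _) _; rewrite -[leRHS]addrA; apply: lerD.
  rewrite normrM (ger0_norm (a0 k)).
  apply: (@le_trans _ _ (1 * u ^+ 2)).
    by apply: ler_pM; [exact: a0|exact: normr_ge0|exact: a1|exact: expRN_onem_bound].
  by rewrite mul1r ler_sqr ?nnegrE// (le_trans u0).
apply: le_trans (ler_normB _ _) _; rewrite normrM !ger0_norm//.
by apply: lerD => //; exact: ler_pM.
Qed.

Lemma pgf_exp_approximation (z : R) : 0 <= z <= 1 ->
  `|\int[P]_w (z ^+ S n w) -
    expR (- \sum_(1 <= k < n.+1) \int[P]_w (1 - z ^+ X k w))| <=
  \sum_(1 <= k < n.+1) nu k ^+ 2 +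
  \sum_(2 <= k < n.+1) (\int[P]_w ((X k.-1 w)%:R * (X k w)%:R) + nu k.-1 * nu k).
Proof.
move=> z01.
set u := fun k => \int[P]_w (1 - z ^+ X k w).
have prodE : expR (- \sum_(1 <= k < n.+1) u k) = \prod_(0 <= k < n) expR (- u k.+1).
  by rewrite -sumrN expR_sum big_add1.
rewrite prodE.
have step k := @pgf_step z k z01.
(* An index shift merges both sums into one over [0 <= k < n]. The factor [(0 < k)%:R] kills the
   neighbour terms at [k = 0], which is why the second sum starts at 2. *)
have -> : \sum_(1 <= k < n.+1) nu k ^+ 2 +
  \sum_(2 <= k < n.+1) (\int[P]_w ((X k.-1 w)%:R * (X k w)%:R) + nu k.-1 * nu k) =
  \sum_(0 <= k < n) (nu k.+1 ^+ 2 + \int[P]_w ((0 < k)%:R * (X k w)%:R * (X k.+1 w)%:R) +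
  (\int[P]_w ((0 < k)%:R * (X k w)%:R)) * nu k.+1).
  under [RHS]eq_bigr do rewrite -addrA.
  rewrite [RHS]big_split/= big_add1/=; congr (_ + _).
  rewrite big_add1/=; case: n => [|n']; first by rewrite !big_geq.
  rewrite [RHS]big_nat_recl//.
  under [X in _ = X + _ + _]eq_Rintegral do rewrite !mul0r.
  under [X in _ = _ + X * _ + _]eq_Rintegral do rewrite !mul0r.
  rewrite prob_Rintegral_cst mul0r !add0r big_add1/=.
  apply: eq_bigr => k _; congr (_ + _ * _); apply: eq_Rintegral => w _; by rewrite mul1r.
apply: (@telescoping_product _ (fun k => \int[P]_w (z ^+ S k w))) => [|k|//].
  under eq_Rintegral do rewrite partial_sum0 expr0.
  exact: prob_Rintegral_cst.
rewrite ger0_norm ?expR_ge0// -[leRHS]expR0 ler_expR oppr_le0.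
by apply: Rintegral_ge0 => w _; case/andP: (onem_exprn_bounds _ (X k.+1 w) z01).
Qed.

(** With [b k] the exponential moment of [S k], the increment [b k.+1 - b k] is the expectation of
    [expR (a * S k) * (expR (a * X k.+1) - 1)]. Dropping [X k] from [S k] costs one factor
    [M = expR (a * N)] and makes the two factors independent; a second [M] comes from bounding the
    last factor by [M * X k.+1]. Hence [b] grows at each step by a factor at most
    [1 + M ^+ 2 * nu k.+1], which is at most [expR (M ^+ 2 * nu k.+1)]. *)
Lemma exp_moment_bound (a : R) : 0 <= a ->
  \int[P]_w (expR (a * (S n w)%:R)) <=
  expR (expR (a * N%:R) ^+ 2 * \sum_(1 <= k < n.+1) nu k).
Proof.
move=> a0; set M := expR (a * N%:R).
have M1 : 1 <= M by rewrite -[leLHS]expR0 ler_expR mulr_ge0.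
pose b k := \int[P]_w (expR (a * (S k w)%:R)).
suff H k : (k <= n)%N -> b k <= expR (M ^+ 2 * \sum_(1 <= j < k.+1) nu j) by exact: H.
have bS m : (m <= n)%N -> bounded_measurable (fun w => expR (a * (S m w)%:R)).
  by move=> mn; exact: (bm_partial_sum _ _ _ _ X_le (fun x => expR (a * x%:R))).
elim: k => [_|k IH kn].
  rewrite big_nil mulr0 expR0 /b.
  under eq_Rintegral do rewrite partial_sum0 mulr0 expR0.
  by rewrite prob_Rintegral_cst.
have bX (phi : nat -> R) : bounded_measurable (fun w => phi (X k.+1 w)).
  by apply: (bm_X _ _ _ _ X_le).
have k'n : (k.-1 <= n)%N by rewrite (leq_trans (leq_pred _))// ltnW.
rewrite big_nat_recr//= mulrDr expRD.
have b0 m : 0 <= b m by apply: Rintegral_ge0 => w _; exact: expR_ge0.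
have SS w : expR (a * (S k w)%:R) <= M * expR (a * (S k.-1 w)%:R).
  case: k kn {IH bX k'n} => [|k] kn /=; first by rewrite ler_peMl ?expR_ge0.
  rewrite -expRD ler_expR -mulrDr ler_wpM2l// partial_sumS natrD addrC lerD2r.
  by rewrite ler_nat; apply: X_le; rewrite /= ltnW.
have SS' w : expR (a * (S k.-1 w)%:R) <= expR (a * (S k w)%:R).
  rewrite ler_expR ler_wpM2l// ler_nat.
  by case: k {kn IH bX k'n SS} => //= k; rewrite partial_sumS leq_addr.
(* Both sides vanish where the variable is 0; elsewhere the left side is at most [M] and the
   variable is at least 1. *)
have EX w : expR (a * (X k.+1 w)%:R) - 1 <= M * (X k.+1 w)%:R.
  have := X_le k.+1 w; rewrite kn => /(_ isT); case: (X k.+1 w) => [|x] xN.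
    by rewrite !mulr0 expR0 subrr.
  rewrite (@le_trans _ _ M)//.
    by rewrite lerBlDr (@le_trans _ _ M) ?lerDl// ler_expR ler_wpM2l// ler_nat.
  by rewrite ler_peMr ?expR_ge0// ler1n.
have EX0 w : 0 <= expR (a * (X k.+1 w)%:R) - 1.
  by rewrite subr_ge0 -[leLHS]expR0 ler_expR mulr_ge0.
have bEX : bounded_measurable (fun w => expR (a * (X k.+1 w)%:R) - 1).
  exact: (bX (fun x => expR (a * x%:R) - 1)).
have bkn : bounded_measurable (fun w => expR (a * (S k w)%:R)) by apply: bS; exact: ltnW.
have nu0 : 0 <= nu k.+1 by apply: Rintegral_ge0.
have -> : b k.+1 = b k + \int[P]_w (expR (a * (S k w)%:R) * (expR (a * (X k.+1 w)%:R) - 1)).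
  rewrite -bm_RintegralD//; last exact: bounded_measurableM.
  by apply: eq_Rintegral => w _; rewrite partial_sumS natrD mulrDr expRD; ring.
have : \int[P]_w (expR (a * (S k w)%:R) * (expR (a * (X k.+1 w)%:R) - 1)) <=
    M * b k.-1 * (M * nu k.+1).
  apply: (@le_trans _ _ (\int[P]_w (M * (expR (a * (S k.-1 w)%:R) * (expR (a * (X k.+1 w)%:R) - 1))))).
    apply: bm_le_Rintegral => [||w].
    - exact: bounded_measurableM.
    - apply: bounded_measurableM; first exact: bounded_measurable_cst.
      by apply: bounded_measurableM => //; exact: bS.
    - by rewrite mulrA; apply: ler_pM => //; exact: expR_ge0.
  rewrite bm_RintegralZl; last by apply: bounded_measurableM => //; exact: bS.
  rewrite (one_dependent_Rintegral _ _ _ _ X_le X_dep (fun x => expR (a * x%:R)) (fun x => expR (a * x%:R) - 1))//.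
  rewrite -mulrA ler_wpM2l ?expR_ge0// ler_wpM2l//; first exact: b0.
  rewrite -bm_RintegralZl; last exact: (bX (fun x => x%:R)).
  apply: bm_le_Rintegral => //; exact: (bX (fun x => M * x%:R)).
have : b k.-1 <= b k by apply: bm_le_Rintegral => //; exact: bS.
have {IH} := IH (ltnW kn).
set E := expR (M ^+ 2 * \sum_(1 <= i < k.+1) nu i).
set I := \int[P]_w _.
set v := nu k.+1 in nu0 *.
move=> bE bb IM.
have : E * (1 + M ^+ 2 * v) <= E * expR (M ^+ 2 * v).
  by rewrite ler_wpM2l ?expR_ge0// expR_ge1Dx.
apply: le_trans; rewrite mulrDr mulr1 lerD//.
apply: le_trans IM _.
have -> : M * b k.-1 * (M * v) = b k.-1 * (M ^+ 2 * v) by ring.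
by rewrite ler_wpM2r ?(le_trans bb)// mulr_ge0// exprn_ge0// expR_ge0.
Qed.

End generating_function_bounds.

(** * Expansion of the exponent in factorial moments *)

Section factorial_moment_expansion.
Context {R : realType}.

Lemma exprn_binomial_subr1 (z : R) (x s : nat) : (x <= s)%N ->
  z ^+ x = \sum_(0 <= m < s.+1) 'C(x, m)%:R * (z - 1) ^+ m.
Proof.
move=> xs; rewrite (@big_cat_nat _ _ _ x.+1)//=.
have -> : \sum_(x.+1 <= m < s.+1) 'C(x, m)%:R * (z - 1) ^+ m = 0.
  by rewrite big_nat big1// => m /andP[xm _]; rewrite bin_small// mul0r.
rewrite addr0 {1}(_ : z = 1 + (z - 1)); last by ring.
rewrite exprDn big_mkord; apply: eq_bigr => i _.
by rewrite expr1n mul1r mulr_natl.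
Qed.

(** The coefficients are binomials, so for [x <= s] the expansion around 1 is exact. For [x > s] the
    falling factorial on the right is at least 1, while the left side is at most 1 plus a sum of
    binomials ['C(x, m)], hence at most [1 + 2 ^+ N]. *)
Lemma exprn_ffact_bound (z : R) (x s N : nat) : 0 <= z <= 1 -> (x <= N)%N ->
  `|z ^+ x - 1 - \sum_(1 <= m < s.+1) (z - 1) ^+ m * (m`!%:R^-1 * (x ^_ m)%:R)|
  <= (1 + 2 ^+ N) * (x ^_ s.+1)%:R.
Proof.
move=> /andP[z0 z1] xN.
have -> : z ^+ x - 1 - \sum_(1 <= m < s.+1) (z - 1) ^+ m * (m`!%:R^-1 * (x ^_ m)%:R)
    = z ^+ x - \sum_(0 <= m < s.+1) 'C(x, m)%:R * (z - 1) ^+ m.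
  rewrite [in RHS]big_ltn// bin0 expr0 mulr1 opprD addrA; congr (_ - _).
  apply: eq_bigr => m _; rewrite mulrC; congr (_ * _).
  by rewrite -bin_ffact natrM mulrC mulfK// pnatr_eq0 -lt0n fact_gt0.
have K0 : 0 <= 1 + 2 ^+ N :> R by rewrite addr_ge0// exprn_ge0.
have [xs|sx] := leqP x s.
  rewrite (exprn_binomial_subr1 z _ _ xs) subrr normr0.
  by apply: mulr_ge0.
apply: (@le_trans _ _ (1 + 2 ^+ N)); last first.
  by rewrite ler_peMr ?ler1n ?ffact_gt0.
apply: le_trans (ler_normB _ _) _; apply: lerD.
  by rewrite ger0_norm ?exprn_ge0// exprn_ile1.
apply: le_trans (ler_norm_sum _ _ _) _.
apply: (@le_trans _ _ (2 ^+ x)); last by rewrite ler_eXn2l ?ltr1n.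
rewrite -natrX -[2%N]/(1 + 1)%N expnDn natr_sum.
rewrite -(big_mkord xpredT (fun i => ('C(x, i) * (1 ^ (x - i) * 1 ^ i))%:R)).
rewrite (@big_cat_nat _ _ _ s.+1 0 x.+1)//=; last by rewrite ltnS ltnW.
rewrite -[leLHS]addr0 lerD ?sumr_ge0//; apply: ler_sum => m _.
rewrite normrM normr_nat !exp1n !muln1 ler_piMr// normrX exprn_ile1//.
by rewrite ler_norml; apply/andP; split; lra.
Qed.

(** Matches the limits of the factorial moments with the compound Poisson exponent: after exchanging
    the sums, the inner one is the binomial expansion of [z ^+ l] around 1 without its constant
    term. *)
Lemma binomial_moments_pgf (z : R) (s : nat) (lam : nat -> R) :
  \sum_(1 <= m < s.+1) (z - 1) ^+ m * \sum_(m <= l < s.+1) 'C(l, m)%:R * lam l =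
  \sum_(1 <= l < s.+1) lam l * (z ^+ l - 1).
Proof.
transitivity (\sum_(1 <= m < s.+1) \sum_(1 <= l < s.+1)
    (z - 1) ^+ m * ('C(l, m)%:R * lam l)).
  apply: eq_big_nat => m /andP[m1 ms]; rewrite -mulr_sumr; congr (_ * _).
  rewrite [RHS](@big_cat_nat _ _ _ m)//=; last exact: ltnW.
  have -> : \sum_(1 <= l < m) 'C(l, m)%:R * lam l = 0.
    by rewrite big_nat big1// => l /andP[_ lm]; rewrite bin_small// mul0r.
  by rewrite add0r.
rewrite exchange_big_nat/=; apply: eq_big_nat => l /andP[l1 ls].
rewrite (@exprn_binomial_subr1 z l s)// [in RHS]big_ltn// bin0 expr0 mulr1.
rewrite addrAC subrr add0r mulr_sumr.
by apply: eq_bigr => m _; ring.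
Qed.

Context {d : measure_display} {T : measurableType d}.
Context (P : probability T R) (X : nat -> {RV P >-> nat}) (n N : nat).
Hypothesis X_le : forall i w, (1 <= i <= n)%N -> (X i w <= N)%N.

(** Integrating [exprn_ffact_bound] at each [X k] and summing over [k] leaves a remainder controlled
    by the factorial moments of order [s.+1] alone. *)
Lemma sum_onem_pgf_bound (z : R) (s : nat) : 0 <= z <= 1 ->
  `|- (\sum_(1 <= k < n.+1) \int[P]_w (1 - z ^+ X k w)) -
    \sum_(1 <= m < s.+1) (z - 1) ^+ m *
      (m`!%:R^-1 * \sum_(1 <= k < n.+1) \int[P]_w (X k w ^_ m)%:R)|
  <= (1 + 2 ^+ N) * \sum_(1 <= k < n.+1) \int[P]_w (X k w ^_ s.+1)%:R.
Proof.
move=> z01.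
have -> : \sum_(1 <= m < s.+1) (z - 1) ^+ m *
      (m`!%:R^-1 * \sum_(1 <= k < n.+1) \int[P]_w (X k w ^_ m)%:R) =
    \sum_(1 <= k < n.+1) \sum_(1 <= m < s.+1) (z - 1) ^+ m *
      (m`!%:R^-1 * \int[P]_w (X k w ^_ m)%:R).
  rewrite exchange_big_nat/=; apply: eq_bigr => m _.
  by rewrite !mulr_sumr.
rewrite -sumrN -sumrB mulr_sumr; apply: le_trans (ler_norm_sum _ _ _) _.
rewrite big_nat [leRHS]big_nat; apply: ler_sum => k; rewrite ltnS => kn.
have bX (phi : nat -> R) : bounded_measurable (fun w => phi (X k w)).
  exact: (bm_X _ _ _ _ X_le).
have -> : - (\int[P]_w (1 - z ^+ X k w)) - \sum_(1 <= m < s.+1) (z - 1) ^+ m *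
      (m`!%:R^-1 * \int[P]_w (X k w ^_ m)%:R) =
    \int[P]_w (z ^+ X k w - 1 - \sum_(1 <= m < s.+1) (z - 1) ^+ m *
      (m`!%:R^-1 * (X k w ^_ m)%:R)).
  rewrite [RHS]bm_RintegralB; last 2 first.
  - exact: (bX (fun x => z ^+ x - 1)).
  - exact: (bX (fun x => \sum_(1 <= m < s.+1) (z - 1) ^+ m * (m`!%:R^-1 * (x ^_ m)%:R))).
  congr (_ - _).
    transitivity (-1 * \int[P]_w (1 - z ^+ X k w)); first by rewrite mulN1r.
    rewrite -bm_RintegralZl; last exact: (bX (fun x => 1 - z ^+ x)).
    by apply: eq_Rintegral => w _; ring.
  rewrite bm_Rintegral_sum => [|m]; last first.
    exact: (bX (fun x => (z - 1) ^+ m * (m`!%:R^-1 * (x ^_ m)%:R))).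
  apply: eq_bigr => m _.
  rewrite bm_RintegralZl; last exact: (bX (fun x => m`!%:R^-1 * (x ^_ m)%:R)).
  by rewrite bm_RintegralZl//; exact: (bX (fun x => (x ^_ m)%:R)).
rewrite -bm_RintegralZl; last exact: (bX (fun x => (x ^_ s.+1)%:R)).
apply: bm_normr_Rintegral => [||w].
- exact: (bX (fun x => z ^+ x - 1 - \sum_(1 <= m < s.+1) (z - 1) ^+ m * (m`!%:R^-1 * (x ^_ m)%:R))).
- exact: (bX (fun x => (1 + 2 ^+ N) * (x ^_ s.+1)%:R)).
- by apply: exprn_ffact_bound => //; exact: X_le.
Qed.

End factorial_moment_expansion.

(** * The generating function of the compound Poisson law *)

Section compound_poisson_generating_function.
Context {R : realType}.
Local Open Scope ereal_scope.

Lemma ge0_integral_nat (mu : {measure set nat -> \bar R}) (f : nat -> R) :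
  (forall k, 0 <= f k)%R ->
  \int[mu]_k (f k)%:E = \sum_(0 <= k <oo) (f k)%:E * mu [set k].
Proof.
move=> f0.
have <- : \bigcup_k [set k] = [set: nat] by apply/seteqP; split => // k _; exists k.
rewrite ge0_integral_bigcup//=; last first.
- by move=> i j _ _ [x [-> ->]].
- by move=> k _; rewrite lee_fin.
apply: eq_eseriesr => k _.
transitivity (\int[mu]_(x in [set k]) (cst (f k)%:E) x).
  by apply: eq_integral => x; rewrite inE => ->.
by rewrite integral_cst.
Qed.

Lemma eseries_expR (x : R) :
  (forall k, 0 <= exp_coeff x k)%R ->
  \sum_(0 <= k <oo) (exp_coeff x k)%:E = (expR x)%:E.
Proof.
move=> x0; rewrite /expR -EFin_lim; last exact: is_cvg_series_exp_coeff.
by apply: congr_lim; apply/funext => n; rewrite /= sumEFin.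
Qed.

Lemma poisson_generating_function (lam y : R) : (0 <= lam)%R -> (0 <= y)%R ->
  \int[poisson_prob lam 0%N]_k (y ^+ k)%:E = (expR (lam * (y - 1)))%:E.
Proof.
move=> lam0 y0; rewrite ge0_integral_nat; last by move=> k; rewrite exprn_ge0.
(* [poisson_prob] is defined by cases on the sign of the mean. At mean 0 it is the Dirac mass at 0,
   and only the term [k = 0] of the series survives. *)
have [lam_gt0|lam_le0] := ltP 0%R lam; last first.
  have -> : lam = 0%R by apply/eqP; rewrite eq_le lam0 lam_le0.
  have dirac0 (A : set nat) : poisson_prob (0 : R) 0%N A = \d_0%N A.
    by rewrite /poisson_prob ltxx.
  under eq_eseriesr do rewrite [X in _ * X]dirac0.
  rewrite mul0r expR0 nneseries_recl//; last first.
    by move=> k _; rewrite mule_ge0// lee_fin exprn_ge0.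
  rewrite diracE mem_set// expr0 mule1 eseries0 ?adde0// => k k0 _.
  by rewrite diracE memNset ?mule0//= => k0'; rewrite -k0' in k0.
have coeff0 k : (0 <= exp_coeff (lam * y) k)%R.
  by rewrite /exp_coeff/= divr_ge0// exprn_ge0// mulr_ge0.
rewrite mulrBr mulr1 addrC expRD EFinM -(eseries_expR (lam * y)%R)//.
rewrite -nneseriesZl; last by move=> k _; rewrite lee_fin.
apply: eq_eseriesr => k _.
have poissonE : poisson_prob lam 0%N [set k] = (poisson_pmf lam k)%:E.
  by rewrite /poisson_prob lam_gt0 esum_set1// lee_fin poisson_pmf_ge0.
rewrite [X in _ * X = _]poissonE -!EFinM /poisson_pmf lam_gt0 /exp_coeff/= exprMn; congr (_%:E).
by ring.
Qed.

Lemma measurable_tuple_nat (s : nat) (A : set (s.-tuple nat)) : measurable A.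
Proof.
apply: countable_measurable; last exact: countableP.
move=> t.
have -> : [set t] = \bigcap_(i in [set: 'I_s]) (@tnth s nat ^~ i @^-1` [set tnth t i]).
  apply/seteqP; split=> [u -> //|u ut].
  by apply: eq_from_tnth => i; exact: ut.
apply: fin_bigcap_measurable => // i _.
by rewrite -[X in measurable X]setTI; exact: measurable_tnth.
Qed.

(** A separate argument [y j] for each coordinate lets the induction on [s] shift [lam] and [y]
    together: Tonelli splits off the first coordinate, and the remaining ones form a product of the
    same kind. *)
Lemma poisson_product_generating_function (s : nat) (lam : nat -> R)
    (y : nat -> R) :
  (forall j, (1 <= j <= s)%N -> (0 <= lam j)%R) ->
  (forall j, (0 <= y j)%R) ->
  \int[poisson_product s lam]_N (\prod_(j < s) y j ^+ tnth N j)%:E =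
  (expR (\sum_(j < s) lam j.+1 * (y j - 1)))%:E.
Proof.
elim: s lam y => [|s IH] lam y lam0 y0.
  under eq_integral do rewrite big_ord0.
  rewrite integral_cst// [X in _ * X]probability_setT big_ord0 expR0.
  by rewrite mule1.
have prod_ge0 m (z : nat -> R) (N : m.-tuple nat) : (forall j, 0 <= z j)%R ->
    0 <= (\prod_(j < m) z j ^+ tnth N j)%:E.
  by move=> z0; rewrite lee_fin; apply: prodr_ge0 => j _; exact: exprn_ge0.
have mf m (f : m.-tuple nat -> \bar R) : measurable_fun setT f.
  by move=> _ B _; exact: measurable_tuple_nat.
rewrite /= ge0_integral_distribution; [|exact: mf|by move=> N; exact: prod_ge0].
rewrite fubini_tonelli1; last 2 first.
- exact: (measurableT_comp (mf _ _) (@measurable_cons_pair s)).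
- by move=> x /=; exact: prod_ge0.
rewrite /fubini_F/=.
transitivity (\int[poisson_prob (lam 1%N) 0%N]_k
    ((expR (\sum_(j < s) lam j.+2 * (y j.+1 - 1)))%:E * (y 0%N ^+ k)%:E)).
  apply: eq_integral => k _.
  rewrite -(IH (fun j => lam j.+1) (fun j => y j.+1)); last 2 first.
  - by move=> j /andP[j1 js]; apply: lam0.
  - by move=> j; exact: y0.
  rewrite muleC -ge0_integralZl//; last 3 first.
  - exact: mf.
  - by move=> N _; rewrite lee_fin; apply: prodr_ge0 => j _; exact: exprn_ge0.
  - by rewrite lee_fin exprn_ge0.
  apply: eq_integral => N _; rewrite big_ord_recl/= tnth0 -EFinM.
  congr (_ * _)%:E; apply: eq_bigr => j _.
  by rewrite tnthS.
rewrite ge0_integralZl//; last by move=> k _; rewrite lee_fin exprn_ge0.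
rewrite poisson_generating_function ?lam0//.
by rewrite -EFinM -expRD addrC [in RHS]big_ord_recl.
Qed.

Lemma compound_poisson_generating_function (s : nat) (lam : nat -> R) (z : R) :
  (forall j, (1 <= j <= s)%N -> (0 <= lam j)%R) -> (0 <= z)%R ->
  \int[compound_poisson s lam]_m (z ^+ m)%:E =
  (expR (\sum_(1 <= l < s.+1) lam l * (z ^+ l - 1)))%:E.
Proof.
move=> lam0 z0; rewrite /compound_poisson ge0_integral_distribution//; last first.
  by move=> m; rewrite lee_fin exprn_ge0.
rewrite big_add1/= big_mkord.
(* Position [j] has weight [j.+1] in [weighted_sum], hence the choice [y j = z ^+ j.+1]. *)
rewrite -(poisson_product_generating_function _ _ (fun j => z ^+ j.+1)%R)//; last first.
  by move=> j; exact: exprn_ge0.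
apply: eq_integral => N _; rewrite /= /weighted_sum; congr (_%:E).
by rewrite -prodrXr; apply: eq_bigr => j _; rewrite exprM.
Qed.

End compound_poisson_generating_function.

(** * Truncated generating functions, distribution functions and tails *)

Section nat_random_variables.
Context {d : measure_display} {T : measurableType d} {R : realType}.
Context (P : probability T R) (Y : T -> nat).
Hypothesis mY : measurable_fun setT Y.

Lemma bounded_measurable_pgf (z : R) : 0 <= z <= 1 ->
  bounded_measurable (fun w => z ^+ Y w).
Proof.
move=> /andP[z0 z1]; split; first exact: (measurable_fun_nat_comp (fun x => z ^+ x)).
by exists 1 => w; rewrite ger0_norm ?exprn_ge0// exprn_ile1.
Qed.

(** The difference is the expectation of [z ^+ Y] over the event that [Y] is at least [k], where
    [z ^+ Y] lies between 0 and [z ^+ k]. *)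
Lemma pgf_truncation (z : R) (k : nat) : 0 <= z <= 1 ->
  0 <= \int[P]_w (z ^+ Y w) -
    \sum_(0 <= j < k) fine (P (Y @^-1` [set j])) * z ^+ j <= z ^+ k.
Proof.
move=> z01; have /andP[z0 z1] := z01.
have mYj j : measurable (Y @^-1` [set j]) by exact: measurable_nat_preimage.
have bI j : bounded_measurable (fun w => z ^+ j * \1_(Y @^-1` [set j]) w : R).
  apply: bounded_measurableM; first exact: bounded_measurable_cst.
  exact: bounded_measurable_indic.
have bpgf := bounded_measurable_pgf z z01.
have -> : \sum_(0 <= j < k) fine (P (Y @^-1` [set j])) * z ^+ j =
    \int[P]_w \sum_(0 <= j < k) z ^+ j * \1_(Y @^-1` [set j]) w.
  rewrite bm_Rintegral_sum//; apply: eq_bigr => j _.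
  rewrite bm_RintegralZl; last exact: bounded_measurable_indic.
  by rewrite Rintegral_indic// mulrC.
rewrite -bm_RintegralB//; last exact: bounded_measurable_sum.
have truncE w : \sum_(0 <= j < k) z ^+ j * \1_(Y @^-1` [set j]) w =
    if (Y w < k)%N then z ^+ Y w else 0.
  have [Yk|kY] := ltnP (Y w) k.
    rewrite (bigD1_seq (Y w)) ?iota_uniq ?mem_index_iota//= big1 ?addr0.
      by rewrite indicE mem_set// mulr1.
    move=> j jY; rewrite indicE memNset ?mulr0// => /= Yj.
    by rewrite Yj eqxx in jY.
  rewrite big_nat big1// => j /andP[_ jk].
  rewrite indicE memNset ?mulr0// => /= Yj.
  by rewrite -Yj ltnNge kY in jk.
have bounds w : 0 <= z ^+ Y w - (if (Y w < k)%N then z ^+ Y w else 0) <= z ^+ k.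
  case: ltnP => [_|kY]; first by rewrite subrr lexx exprn_ge0.
  by rewrite subr0 exprn_ge0//= ler_wiXn2l.
apply/andP; split.
  by apply: Rintegral_ge0 => w _; rewrite truncE; case/andP: (bounds w).
rewrite -[leRHS](prob_Rintegral_cst P); apply: bm_le_Rintegral => [||w].
- by apply: bounded_measurableB => //; exact: bounded_measurable_sum.
- exact: bounded_measurable_cst.
- by rewrite truncE; case/andP: (bounds w).
Qed.

Lemma nat_cdf_sum (k : nat) :
  fine (P (Y @^-1` [set m | (m <= k)%N])) =
  \sum_(0 <= j < k.+1) fine (P (Y @^-1` [set j])).
Proof.
have mYA A : measurable (Y @^-1` A) by exact: measurable_nat_preimage.
rewrite -Rintegral_indic//.
under [RHS]eq_bigr do rewrite -Rintegral_indic//.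
rewrite -bm_Rintegral_sum => [|j]; last exact: bounded_measurable_indic.
apply: eq_Rintegral => w _; rewrite indicE.
have [Yk|kY] := leqP (Y w) k.
  rewrite mem_set// (bigD1_seq (Y w)) ?iota_uniq ?mem_index_iota//= big1 ?addr0.
    by rewrite indicE mem_set.
  move=> j jY; rewrite indicE memNset// => /= Yj.
  by rewrite Yj eqxx in jY.
rewrite memNset/=; last by rewrite leqNgt kY.
rewrite big_nat big1// => j /andP[_ jk].
rewrite indicE memNset// => /= Yj.
by rewrite -Yj ltnS leqNgt kY in jk.
Qed.

(** Markov's inequality for [y ^+ Y]. The moment is an extended-real integral so that the compound
    Poisson law is covered, where [y ^+ m] is unbounded for [y > 1]. *)
Lemma nat_tail_bound (y M : R) (k : nat) : 1 <= y ->
  (\int[P]_w (y ^+ Y w)%:E <= M%:E)%E ->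
  1 - fine (P (Y @^-1` [set m | (m <= k)%N])) <= M / y ^+ k.
Proof.
move=> y1 yM.
have y0 : 0 < y by exact: lt_le_trans y1.
set A := Y @^-1` [set m | (m <= k)%N].
have mA : measurable A by exact: measurable_nat_preimage.
have mC : measurable (~` A) by exact: measurableC.
have -> : 1 - fine (P A) = fine (P (~` A)).
  by rewrite probability_setC// fineB ?fin_num_measure.
rewrite ler_pdivlMr ?exprn_gt0// mulrC -lee_fin EFinM fineK ?fin_num_measure//.
apply: le_trans yM; rewrite -integral_cst//.
have my (B : set T) : measurable_fun B (fun w => (y ^+ Y w)%:E).
  apply: measurable_funTS; apply/measurable_EFinP.
  exact: (measurable_fun_nat_comp (fun x => y ^+ x)).
apply: (@le_trans _ _ (\int[P]_(w in ~` A) (y ^+ Y w)%:E)%E).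
  apply: ge0_le_integral => //.
  - by move=> w _; rewrite lee_fin exprn_ge0// ltW.
  - move=> w /= /negP; rewrite -ltnNge => kY.
    by rewrite lee_fin ler_weXn2l// ltnW.
apply: ge0_subset_integral => //.
by move=> w _; rewrite lee_fin exprn_ge0// ltW.
Qed.

End nat_random_variables.

(** * Limits of coefficients and of dominated series *)

Section real_limits.
Context {R : realType}.

Lemma cvg_sum_nat (a b : nat) (f : nat -> nat -> R) (l : nat -> R) :
  (forall j, (a <= j < b)%N -> f n j @[n --> \oo] --> l j) ->
  \sum_(a <= j < b) f n j @[n --> \oo] --> \sum_(a <= j < b) l j.
Proof.
elim: b => [|b IH] fl.
  rewrite big_geq//; under eq_fun do rewrite big_geq//.
  exact: cvg_cst.
have [ab|ba] := leqP a b; last first.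
  rewrite big_geq//; under eq_fun do rewrite big_geq//.
  exact: cvg_cst.
rewrite big_nat_recr//; under eq_fun do rewrite big_nat_recr//.
apply: cvgD; last by apply: fl; rewrite ab ltnSn.
by apply: IH => j /andP[aj jb]; apply: fl; rewrite aj ltnW.
Qed.

(* Letting [z] tend to 0 isolates the coefficient of [z ^+ k] once the lower
   ones are known to converge. *)
Lemma pgf_cvg_coefficients (g : nat -> R -> R) (g' : R -> R)
    (p : nat -> nat -> R) (p' : nat -> R) :
  (forall n z k, 0 <= z <= 1 ->
    0 <= g n z - \sum_(0 <= j < k) p n j * z ^+ j <= z ^+ k) ->
  (forall z k, 0 <= z <= 1 ->
    0 <= g' z - \sum_(0 <= j < k) p' j * z ^+ j <= z ^+ k) ->
  (forall z, 0 <= z <= 1 -> g n z @[n --> \oo] --> g' z) ->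
  forall k, p n k @[n --> \oo] --> p' k.
Proof.
move=> gp gp' gg'; elim/ltn_ind => k IH.
apply/cvgrPdist_le => e e0.
(* The terms beyond the [k]-th contribute at most [z ^+ k.+1], which this choice bounds by
   [z ^+ k * (e / 2)]. The limit of the lower-order remainder is taken with the same tolerance, and
   dividing by [z ^+ k] leaves [e]. *)
pose z : R := Num.min 1 (e / 2).
have z0 : 0 < z by rewrite lt_min ltr01 divr_gt0.
have z1 : z <= 1 by rewrite ge_min lexx.
have ze : z <= e / 2 by rewrite ge_min lexx orbT.
have z01 : 0 <= z <= 1 by rewrite ltW.
have zk0 : 0 < z ^+ k by rewrite exprn_gt0.
have lim : g n z - \sum_(0 <= j < k) p n j * z ^+ j @[n --> \oo] -->
    g' z - \sum_(0 <= j < k) p' j * z ^+ j.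
  apply: cvgB; first exact: gg'.
  by apply: cvg_sum_nat => j /andP[_ jk]; apply: cvgMl; exact: IH.
have eps0 : 0 < z ^+ k * (e / 2) by rewrite mulr_gt0// divr_gt0.
move/cvgrPdist_le : lim => /(_ _ eps0); apply: filterS => n.
have := gp n z k.+1 z01; have := gp' z k.+1 z01.
rewrite !big_nat_recr//= exprS.
set A := \sum_(0 <= j < k) _; set A' := \sum_(0 <= j < k) _.
move=> /andP[h1 h2] /andP[h3 h4]; rewrite ler_norml => /andP[h5 h6].
have zz : z * z ^+ k <= z ^+ k * (e / 2) by rewrite mulrC ler_pM2l.
rewrite -(ler_pM2l zk0) -{1}(ger0_norm (ltW zk0)) -normrM ler_norml.
by apply/andP; split; nra.
Qed.

Lemma ge0_cvge0 (U : nat -> \bar R) : (forall n, (0 <= U n)%E) ->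
  (forall e : R, 0 < e -> \forall n \near \oo, (U n <= e%:E)%E) ->
  U n @[n --> \oo] --> 0%E.
Proof.
move=> U0 Ue; apply/fine_cvgP; split.
  near=> n; rewrite ge0_fin_numE//.
  by apply: (@le_lt_trans _ _ 1%:E); [near: n; exact: Ue|exact: ltry].
apply/cvgrPdist_le => e e0; have := Ue e e0; apply: filterS => n Un.
have Ufin : U n \is a fin_num by rewrite ge0_fin_numE// (le_lt_trans Un)// ltry.
by rewrite sub0r normrN ger0_norm ?fine_ge0// -lee_fin fineK.
Unshelve. all: by end_near. Qed.

(** Tannery's argument: cut the series where the geometric tail falls below [e / 2]; the finite head
    tends to 0 term by term. Domination for large [n] suffices. *)
Lemma cvg_dominated_series (u : nat -> nat -> R) (C q : R) :
  0 <= C -> 0 <= q < 1 -> (forall n k, 0 <= u n k) ->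
  (\forall n \near \oo, forall k, u n k <= C * q ^+ k) ->
  (forall k, u n k @[n --> \oo] --> 0) ->
  (\sum_(0 <= k <oo) (u n k)%:E)%E @[n --> \oo] --> 0%E.
Proof.
move=> C0 /andP[q0 q1] u0 uC ucvg.
apply: ge0_cvge0 => [n|e e0].
  by apply: nneseries_ge0 => k _ _; rewrite lee_fin.
have v0 k : (0 <= (C * q ^+ k)%:E)%E by rewrite lee_fin mulr_ge0// exprn_ge0.
have vfin : (\sum_(0 <= k <oo) (C * q ^+ k)%:E < +oo)%E.
  have cv : cvgn (series (geometric C q)).
    by apply: is_cvg_geometric_series; rewrite ger0_norm.
  rewrite [ltLHS](_ : _ = (limn (series (geometric C q)))%:E) ?ltry//.
  rewrite -EFin_lim//; apply: congr_lim; apply/funext => n.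
  by rewrite /= sumEFin.
have := nneseries_tail_cvg vfin (fun k _ => v0 k).
move=> /fine_cvgP[tfin /cvgrPdist_le /(_ (e / 2))].
rewrite divr_gt0// => /(_ isT) tail.
have [N /=] : exists N, (\sum_(N <= k <oo) (C * q ^+ k)%:E <= (e / 2)%:E)%E.
  near \oo => N; exists N.
  have Nfin : (\sum_(N <= k <oo) (C * q ^+ k)%:E)%E \is a fin_num by near: N.
  rewrite -[leLHS]fineK// lee_fin (le_trans (ler_norm _))//.
  by rewrite -normrN -sub0r; near: N.
move=> tailN.
have head : \sum_(0 <= k < N) u n k @[n --> \oo] --> (0 : R).
  rewrite -[X in _ --> X](_ : \sum_(0 <= k < N) 0 = 0); last by rewrite big1.
  by apply: cvg_sum_nat => k _; exact: ucvg.
move/cvgrPdist_le : head => /(_ (e / 2)); rewrite divr_gt0// => /(_ isT) head.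
near=> n.
rewrite (nneseries_split 0%N N) => [|k _]; last by rewrite lee_fin.
rewrite add0n [e]splitr EFinD; apply: leeD.
  rewrite sumEFin lee_fin (le_trans (ler_norm _))//.
  by rewrite -normrN -sub0r; near: n.
apply: le_trans tailN; apply: lee_nneseries => [k _ _|k _].
  by rewrite lee_fin.
rewrite lee_fin; move: k.
by near: n.
Unshelve. all: by end_near. Qed.

End real_limits.

(** * Convergence for the triangular array *)

Section triangular_array.
Context {R : realType} (s : nat) (lam : nat -> R) (d : nat -> measure_display).
Context (T : forall n, measurableType (d n)) (P : forall n, probability (T n) R).
Context (X : forall n, nat -> {RV (P n) >-> nat}) (N : nat).
Hypothesis s_gt0 : (1 <= s)%N.
Hypothesis lam_ge0 : forall j, (1 <= j <= s)%N -> 0 <= lam j.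
Hypothesis X_dep : forall n, one_dependent (P n) n (fun i => X n i).
Hypothesis X_le : forall n i w, (1 <= i <= n)%N -> (X n i w <= N)%N.

Local Notation S n := (partial_sum (P n) (X n) n).
Local Notation nu m n k := (\int[P n]_w (X n k w ^_ m)%:R).
Local Notation mean n k := (\int[P n]_w (X n k w)%:R).
Local Notation cov n k := (\int[P n]_w ((X n k.-1 w)%:R * (X n k w)%:R)
  - mean n k.-1 * mean n k).

Let bX n (phi : nat -> R) k : (1 <= k <= n)%N ->
  bounded_measurable (fun w => phi (X n k w)).
Proof. exact: (bm_X _ _ _ _ (X_le n)). Qed.

Lemma factorial_moment_nu n k m : (1 <= k <= n)%N ->
  factorial_moment (P n) (X n k) m = (nu m n k)%:E.
Proof.
move=> kn; rewrite /factorial_moment unlock EFin_Rintegral//.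
exact: (bX n (fun x => (x ^_ m)%:R)).
Qed.

Lemma covariance_cov n k : (2 <= k <= n)%N ->
  covariance (P n) (fun w => (X n k.-1 w)%:R) (fun w => (X n k w)%:R) =
  (cov n k)%:E.
Proof.
move=> /andP[k2 kn].
have bk : bounded_measurable (fun w => (X n k w)%:R : R).
  by apply: (bX n (fun x => x%:R)); rewrite (ltnW k2).
have bk' : bounded_measurable (fun w => (X n k.-1 w)%:R : R).
  apply: (bX n (fun x => x%:R)).
  by rewrite -ltnS prednK ?k2 ?(leq_trans (leq_pred _))// ltnW.
have bkk := bounded_measurableM _ _ bk' bk.
rewrite covarianceE; last 3 first.
- by apply/Lfun1_integrable; exact: bounded_measurable_integrable.
- by apply/Lfun1_integrable; exact: bounded_measurable_integrable.
- by apply/Lfun1_integrable; exact: (bounded_measurable_integrable (P n) _ bkk).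
by rewrite unlock EFinB EFinM !EFin_Rintegral.
Qed.

Hypothesis max_cvg0 : exists2 M : nat -> R, M n @[n --> \oo] --> 0 &
  \forall n \near \oo, forall k, (1 <= k <= n)%N -> mean n k <= M n.
Hypothesis moments_cvg : forall m, (1 <= m <= s)%N ->
  m`!%:R^-1 * (\sum_(1 <= k < n.+1) nu m n k) @[n --> \oo]
  --> \sum_(m <= l < s.+1) 'C(l, m)%:R * lam l.
Hypothesis last_cvg0 : \sum_(1 <= k < n.+1) nu s.+1 n k @[n --> \oo] --> 0.
Hypothesis cov_cvg0 : \sum_(2 <= k < n.+1) `|cov n k| @[n --> \oo] --> 0.

Let mean_ge0 n k : 0 <= mean n k.
Proof. by apply: Rintegral_ge0. Qed.

Lemma sum_mean_cvg : \sum_(1 <= k < n.+1) mean n k @[n --> \oo] -->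
  \sum_(1 <= l < s.+1) 'C(l, 1)%:R * lam l.
Proof.
have := moments_cvg 1; rewrite s_gt0 => /(_ isT); apply: cvg_trans.
apply: near_eq_cvg; apply: nearW => n.
rewrite invr1 mul1r; apply: eq_bigr => k _; apply: eq_Rintegral => w _.
by rewrite ffactn1.
Qed.

(** A square or a neighbouring product of means is at most [M n] times a mean, and the sums of means
    converge. A mixed moment is a covariance plus a product of means, so products of means occur
    twice; with the squares this gives the factor 3 below. *)
Lemma pgf_error_cvg0 :
  \sum_(1 <= k < n.+1) mean n k ^+ 2 +
  \sum_(2 <= k < n.+1) ((\int[P n]_w ((X n k.-1 w)%:R * (X n k w)%:R)) +
    mean n k.-1 * mean n k) @[n --> \oo] --> 0.
Proof.
have [M M0 meanM] := max_cvg0.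
have bound0 : M n * 3 * (\sum_(1 <= k < n.+1) mean n k) +
    \sum_(2 <= k < n.+1) `|cov n k| @[n --> \oo] --> 0.
  rewrite -[X in _ --> X](addr0 0); apply: cvgD; last exact: cov_cvg0.
  rewrite -[X in _ --> X](mul0r (\sum_(1 <= l < s.+1) 'C(l, 1)%:R * lam l)).
  apply: cvgM; last exact: sum_mean_cvg.
  by rewrite -[X in _ --> X](mul0r 3); apply: cvgMl.
apply: (squeeze_cvgr _ (cvg_cst 0) bound0).
apply: filterS meanM => n meanM.
have ge0 : 0 <= \sum_(1 <= k < n.+1) mean n k ^+ 2 +
    \sum_(2 <= k < n.+1) ((\int[P n]_w ((X n k.-1 w)%:R * (X n k w)%:R)) +
    mean n k.-1 * mean n k).
  apply: addr_ge0; apply: sumr_ge0 => k _; first exact: exprn_ge0.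
  by rewrite addr_ge0 ?mulr_ge0//; apply: Rintegral_ge0 => w _; rewrite mulr_ge0.
rewrite ge0/=.
have sq_le : \sum_(1 <= k < n.+1) mean n k ^+ 2 <=
    M n * \sum_(1 <= k < n.+1) mean n k.
  rewrite mulr_sumr big_nat [leRHS]big_nat; apply: ler_sum => k; rewrite ltnS => kn.
  by rewrite expr2 ler_wpM2r// meanM.
have prod_le : \sum_(2 <= k < n.+1) mean n k.-1 * mean n k <=
    M n * \sum_(1 <= k < n.+1) mean n k.
  apply: (@le_trans _ _ (\sum_(2 <= k < n.+1) M n * mean n k)).
    rewrite big_nat [leRHS]big_nat; apply: ler_sum => k /andP[k2 kn].
    rewrite ler_wpM2r// meanM// -ltnS prednK ?k2; last exact: ltnW.
    by rewrite (leq_trans (leq_pred _)).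
  (* The sum from 2 omits the first mean. Putting it back needs [0 <= M n], which follows from
     [meanM] at index 1 once [n] is positive; for [n = 0] both sums are empty. *)
  have [n1|n0] := leqP 1 n; last first.
    by move: n0; rewrite ltnS leqn0 => /eqP ->; rewrite !big_geq// mulr0.
  rewrite -mulr_sumr [in leRHS]big_ltn// mulrDr lerDr mulr_ge0//.
  by apply: le_trans (meanM 1%N _); rewrite ?n1.
have cov_le : \sum_(2 <= k < n.+1) ((\int[P n]_w ((X n k.-1 w)%:R * (X n k w)%:R)) +
    mean n k.-1 * mean n k) <=
    \sum_(2 <= k < n.+1) `|cov n k| + 2 * \sum_(2 <= k < n.+1) mean n k.-1 * mean n k.
  rewrite mulr_sumr -big_split/=; apply: ler_sum => k _.
  rewrite mulr_natl mulr2n addrA lerD2r -lerBlDr ler_norm//.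
set A := \sum_(1 <= k < n.+1) mean n k ^+ 2 in sq_le *.
set B := \sum_(2 <= k < n.+1) _ in cov_le *.
set C := \sum_(2 <= k < n.+1) _ in cov_le *.
set D := \sum_(2 <= k < n.+1) _ in cov_le prod_le.
set L := \sum_(1 <= k < n.+1) _ in sq_le prod_le *.
lra.
Qed.

Lemma sum_onem_pgf_cvg (z : R) : 0 <= z <= 1 ->
  - (\sum_(1 <= k < n.+1) \int[P n]_w (1 - z ^+ X n k w)) @[n --> \oo] -->
  \sum_(1 <= l < s.+1) lam l * (z ^+ l - 1).
Proof.
move=> z01; rewrite -binomial_moments_pgf.
(* [A n] is the expansion to order [s], whose limit comes from [moments_cvg]; the remainder is
   squeezed to 0 by the moments of order [s.+1]. *)
pose A n := \sum_(1 <= m < s.+1) (z - 1) ^+ m *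
  (m`!%:R^-1 * \sum_(1 <= k < n.+1) nu m n k).
have A_cvg : A n @[n --> \oo] --> \sum_(1 <= m < s.+1) (z - 1) ^+ m *
    \sum_(m <= l < s.+1) 'C(l, m)%:R * lam l.
  apply: cvg_sum_nat => m; rewrite ltnS => ms.
  by apply: cvgMr; exact: moments_cvg.
rewrite -[X in _ --> X]addr0.
have -> : (fun n => - (\sum_(1 <= k < n.+1) \int[P n]_w (1 - z ^+ X n k w))) =
    (fun n => A n + (- (\sum_(1 <= k < n.+1) \int[P n]_w (1 - z ^+ X n k w)) - A n)).
  by apply/funext => n; rewrite addrC subrK.
apply: cvgD => //; apply: norm_cvg0.
have bound0 : (1 + 2 ^+ N) * \sum_(1 <= k < n.+1) nu s.+1 n k @[n --> \oo] --> (0 : R).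
  by rewrite -[X in _ --> X](mulr0 (1 + 2 ^+ N)); apply: cvgMr; exact: last_cvg0.
apply: (squeeze_cvgr _ (cvg_cst 0) bound0); apply: nearW => n.
rewrite normr_ge0/=; apply: sum_onem_pgf_bound => //.
exact: X_le.
Qed.

Lemma pgf_cvg (z : R) : 0 <= z <= 1 ->
  \int[P n]_w (z ^+ S n w) @[n --> \oo] -->
  \int[compound_poisson s lam]_m (z ^+ m).
Proof.
move=> z01; have /andP[z0 z1] := z01.
have -> : \int[compound_poisson s lam]_m (z ^+ m) =
    expR (\sum_(1 <= l < s.+1) lam l * (z ^+ l - 1)).
  by rewrite /Rintegral compound_poisson_generating_function.
rewrite -[X in _ --> X]addr0.
pose B n := expR (- (\sum_(1 <= k < n.+1) \int[P n]_w (1 - z ^+ X n k w))).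
have -> : (fun n => \int[P n]_w (z ^+ S n w)) =
    (fun n => B n + ((\int[P n]_w (z ^+ S n w)) - B n)).
  by apply/funext => n; rewrite addrC subrK.
apply: cvgD.
  by apply: continuous_cvg; [exact: continuous_expR|exact: sum_onem_pgf_cvg].
apply: norm_cvg0; apply: (squeeze_cvgr _ (cvg_cst 0) pgf_error_cvg0).
apply: nearW => n; rewrite normr_ge0/=.
exact: (pgf_exp_approximation _ _ _ _ (X_le n) (X_dep n)).
Qed.

Lemma cdf_cvg (k : nat) :
  fine (P n [set w | (S n w <= k)%N]) @[n --> \oo] -->
  fine (compound_poisson s lam [set m | (m <= k)%N]).
Proof.
rewrite [X in _ --> X](nat_cdf_sum (compound_poisson s lam) id)//.
rewrite (_ : (fun n => _) = fun n =>
    \sum_(0 <= j < k.+1) fine (P n (S n @^-1` [set j]))); last first.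
  apply/funext => n; rewrite -nat_cdf_sum//; exact: measurable_partial_sum.
apply: cvg_sum_nat => j _.
apply: (pgf_cvg_coefficients (fun n z => \int[P n]_w (z ^+ S n w))
  (fun z => \int[compound_poisson s lam]_m (z ^+ m))
  (fun n j => fine (P n (S n @^-1` [set j])))
  (fun j => fine (compound_poisson s lam [set j]))).
- move=> n z i z01; apply: pgf_truncation => //; exact: measurable_partial_sum.
- by move=> z i z01; apply: (pgf_truncation (compound_poisson s lam) id).
- exact: pgf_cvg.
Qed.

Lemma exponential_cdf_distance_cvg0 (h : R) : 0 < h ->
  (\sum_(0 <= k <oo) (expR (h * k%:R) *
     `|fine (P n [set w | (S n w <= k)%N])
       - fine (compound_poisson s lam [set m | (m <= k)%N])|)%:E)%E
  @[n --> \oo] --> 0%E.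
Proof.
move=> h0.
(* The extra 1 in the exponent makes [expR (h * k)] times a tail of order [y ^- k] decay like
   [expR (- k)], which gives the geometric domination. *)
pose y : R := expR (h + 1).
have h1 : 0 <= h + 1 by rewrite addr_ge0// ltW.
have y1 : 1 <= y by rewrite -[leLHS]expR0 ler_expR.
have y0 : 0 < y by exact: expR_gt0.
(* [M1] bounds the moment of [y ^+ S n] as soon as the sum of means is within 1 above its limit,
   hence for all large [n]. [M2] is the compound Poisson generating function at [y]. *)
pose M1 : R := expR (expR ((h + 1) * N%:R) ^+ 2 *
  (\sum_(1 <= l < s.+1) 'C(l, 1)%:R * lam l + 1)).
pose M2 : R := expR (\sum_(1 <= l < s.+1) lam l * (y ^+ l - 1)).
apply: (@cvg_dominated_series _ _ (M1 + M2) (expR (- 1))).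
- by rewrite addr_ge0// expR_ge0.
- by rewrite expR_ge0/= expR_lt1 ltrN10.
- by move=> n k; rewrite mulr_ge0// expR_ge0.
- have bounded : \forall n \near \oo, \sum_(1 <= k < n.+1) mean n k <=
      \sum_(1 <= l < s.+1) 'C(l, 1)%:R * lam l + 1.
    by apply: (cvgr_le _ sum_mean_cvg); rewrite ltrDl.
  apply: filterS bounded => n bounded k.
  have tail1 : 1 - fine (P n [set w | (S n w <= k)%N]) <= M1 / y ^+ k.
    apply: (nat_tail_bound (P n) (S n)) => //; first exact: measurable_partial_sum.
    rewrite -EFin_Rintegral ?lee_fin; last first.
      exact: (bm_partial_sum _ _ _ _ (X_le n) (fun x => y ^+ x)).
    have := exp_moment_bound _ _ _ _ (X_le n) (X_dep n) _ h1.
    under eq_Rintegral do rewrite mulrC expRM_natl.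
    move=> /le_trans; apply; rewrite ler_expR ler_wpM2l// exprn_ge0// expR_ge0.
  have tail2 : 1 - fine (compound_poisson s lam [set m | (m <= k)%N]) <= M2 / y ^+ k.
    apply: (nat_tail_bound (compound_poisson s lam) id) => //.
    by rewrite compound_poisson_generating_function// ltW.
  have le1 (d0 : measure_display) (T0 : measurableType d0)
      (P0 : probability T0 R) (A : set T0) : measurable A -> fine (P0 A) <= 1.
    by move=> mA; rewrite -lee_fin fineK ?fin_num_measure// probability_le1.
  have F1 : fine (P n [set w | (S n w <= k)%N]) <= 1.
    apply: le1; apply: (measurable_nat_preimage (S n) [set m | (m <= k)%N]).
    exact: measurable_partial_sum.
  have G1 : fine (compound_poisson s lam [set m | (m <= k)%N]) <= 1 by exact: le1.
  have -> : (M1 + M2) * expR (- 1) ^+ k =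
      expR (h * k%:R) * ((M1 + M2) / y ^+ k).
    have hk : expR (h * k%:R) = expR h ^+ k by rewrite mulrC expRM_natl.
    have yk : y ^+ k = expR h ^+ k * expR 1 ^+ k by rewrite /y expRD exprMn.
    rewrite hk yk expRN exprVn; field.
    by rewrite !expf_neq0// gt_eqF// expR_gt0.
  (* Both distribution functions are at most 1, so their distance is at most the larger of the two
     tails, hence at most the sum of the tail bounds. *)
  rewrite ler_wpM2l ?expR_ge0// mulrDl.
  by rewrite ler_norml; apply/andP; split; lra.
- move=> k; rewrite -[X in _ --> X](mulr0 (expR (h * k%:R))).
  apply: cvgMr; apply/norm_cvg0P.
  rewrite -[X in _ --> X](subrr (fine (compound_poisson s lam [set m | (m <= k)%N]))).
  by apply: cvgB; [exact: cdf_cvg|exact: cvg_cst].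
Qed.

End triangular_array.

(** * Transfer between extended-real and real sequences *)

Theorem corollary2p1 (R : realType) (C0 h : R) (s : nat) (lam : nat -> R)
    (d : nat -> measure_display) (T : forall n, measurableType (d n))
    (P : forall n, probability (T n) R)
    (X : forall n, nat -> {RV (P n) >-> nat})
    (hC0 : 1 <= C0) (hh : 0 < h) (hs : (1 <= s)%N)
    (hlam : forall j, (1 <= j <= s)%N -> 0 <= lam j)
    (hdep : forall n, one_dependent (P n) n (fun i => X n i))
    (hbound : forall n i w, (1 <= i <= n)%N -> (X n i w)%:R <= C0)
    (hmax : (\big[maxe/0]_(1 <= j < n.+1)
        factorial_moment (P n) (X n j) 1)%E @[n --> \oo] --> 0%E)
    (hmoments : forall m, (1 <= m <= s)%N ->
      ((m`!%:R^-1)%:E * \sum_(1 <= j < n.+1)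
        factorial_moment (P n) (X n j) m)%E @[n --> \oo]
      --> (\sum_(m <= l < s.+1) 'C(l, m)%:R * lam l)%:E)
    (hlast : (\sum_(1 <= j < n.+1)
        factorial_moment (P n) (X n j) s.+1)%E @[n --> \oo] --> 0%E)
    (hcov : (\sum_(2 <= j < n.+1)
        `|covariance (P n) (fun w => (X n j.-1 w)%:R)
                           (fun w => (X n j w)%:R)|)%E @[n --> \oo] --> 0%E) :
  (\sum_(0 <= k <oo) (expR (h * k%:R))%:E *
     `|P n [set w | (\sum_(1 <= i < n.+1) X n i w <= k)%N]
       - compound_poisson s lam [set m | (m <= k)%N]|)%E @[n --> \oo] --> 0%E.
Proof.
pose N := Num.Def.archi_bound C0.
have X_le n i w : (1 <= i <= n)%N -> (X n i w <= N)%N.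
  move=> kn; have XC := hbound n i w kn; rewrite -(ler_nat R) (le_trans XC)// ltW//.
  by rewrite archi_boundP// (le_trans _ hC0).
have momentE n k m : (1 <= k < n.+1)%N -> factorial_moment (P n) (X n k) m =
    (\int[P n]_w (X n k w ^_ m)%:R)%:E.
  by move=> kn; exact: (factorial_moment_nu _ _ _ _ _ X_le).
have sumE n m : (\sum_(1 <= j < n.+1) factorial_moment (P n) (X n j) m)%E =
    (\sum_(1 <= j < n.+1) \int[P n]_w (X n j w ^_ m)%:R)%:E.
  by rewrite -sumEFin; apply: eq_big_nat => k kn; exact: momentE.
have max_cvg0 : exists2 M : nat -> R, M n @[n --> \oo] --> 0 &
    \forall n \near \oo, forall k, (1 <= k <= n)%N ->
      \int[P n]_w (X n k w)%:R <= M n.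
  (* [fine] sends infinite values to 0, so it majorizes the means only where the maximum is finite;
     convergence to 0 guarantees this for large [n]. *)
  exists (fun n => fine (\big[maxe/0]_(1 <= j < n.+1)
    factorial_moment (P n) (X n j) 1)%E); first exact: fine_cvg hmax.
  apply: filterS (cvg_is_fine hmax) => n maxfin k kn.
  rewrite -lee_fin [leRHS]fineK//.
  have mean_le : (factorial_moment (P n) (X n k) 1 <=
      \big[maxe/0]_(1 <= j < n.+1) factorial_moment (P n) (X n j) 1)%E.
    by apply: (le_bigmax_seq _ k xpredT) => //; rewrite mem_index_iota ltnS.
  apply: le_trans mean_le; rewrite momentE// lee_fin.
  by under [leRHS]eq_Rintegral do rewrite ffactn1.
have moments_cvg m : (1 <= m <= s)%N ->
    m`!%:R^-1 * (\sum_(1 <= k < n.+1) \int[P n]_w (X n k w ^_ m)%:R) @[n --> \oo]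
    --> \sum_(m <= l < s.+1) 'C(l, m)%:R * lam l.
  move=> /hmoments; under eq_fun do rewrite sumE -EFinM.
  exact: fine_cvg.
have last_cvg0 : \sum_(1 <= k < n.+1) \int[P n]_w (X n k w ^_ s.+1)%:R
    @[n --> \oo] --> 0.
  move: hlast; under eq_fun do rewrite sumE.
  exact: fine_cvg.
have cov_cvg0 : \sum_(2 <= k < n.+1)
    `|(\int[P n]_w ((X n k.-1 w)%:R * (X n k w)%:R)) -
      (\int[P n]_w (X n k.-1 w)%:R) * (\int[P n]_w (X n k w)%:R)| @[n --> \oo] --> 0.
  have covE n : (\sum_(2 <= j < n.+1)
      `|covariance (P n) (fun w => (X n j.-1 w)%:R) (fun w => (X n j w)%:R)|)%E =
      (\sum_(2 <= k < n.+1) `|(\int[P n]_w ((X n k.-1 w)%:R * (X n k w)%:R)) -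
        (\int[P n]_w (X n k.-1 w)%:R) * (\int[P n]_w (X n k w)%:R)|)%:E.
    rewrite -sumEFin; apply: eq_big_nat => k kn.
    by rewrite (covariance_cov _ _ _ _ _ X_le).
  move: hcov; under eq_fun do rewrite covE.
  exact: fine_cvg.
have := exponential_cdf_distance_cvg0 s lam d T P X N hs hlam hdep X_le
  max_cvg0 moments_cvg last_cvg0 cov_cvg0 h hh.
apply: cvg_trans; apply: near_eq_cvg; apply: nearW => n /=.
apply: eq_eseriesr => k _.
rewrite EFinM; congr (_ * _)%E.
have cdf_fin (d0 : measure_display) (T0 : measurableType d0) (P0 : probability T0 R)
    (Y : T0 -> nat) : measurable_fun setT Y ->
    P0 [set w | (Y w <= k)%N] \is a fin_num.
  by move=> mY; apply: fin_num_measure; exact: (measurable_nat_preimage Y [set m | (m <= k)%N]).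
rewrite -[in RHS](fineK (cdf_fin _ _ (P n) _ (measurable_partial_sum (P n) (X n) n))).
by rewrite -[in RHS](fineK (cdf_fin _ _ (compound_poisson s lam) id (@measurable_id _ _ setT))).
Qed.
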